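(* Let $(X,x_0)$ be a pointed topological space, $n\ge 2$, and let $H\le \pi_n(X,x_0)$ be a subgroup. Then $X$ is $n$-semilocally $H$-connected at $x_0$ if and only if $H$ is an open subgroup of $\pi_n^{wh}(X,x_0)$.
   Context: For an open neighbourhood $U$ of $x_0$ in $X$, let $\pi_n(i)(\pi_n(U,x_0))\le\pi_n(X,x_0)$ be the image of the homomorphism induced by the inclusion $i:U\hookrightarrow X$. For a subgroup $H$ of $\pi_n(X,x_0)$, $X$ is called $n$-semilocally $H$-connected at $x_0$ if there exists an open neighbourhood $U$ of $x_0$ with $\pi_n(i)(\pi_n(U,x_0))\le H$. A neighbourhood family on a group $G$ is a (nonempty) collection $\Sigma$ of subgroups such that for all $H,K\in\Sigma$ there is $S\in\Sigma$ with $S\subseteq H\cap K$; the subgroup topology determined by $\Sigma$ is the topology on $G$ having as a basis all left cosets of elements of $\Sigma$. The whisker topology $\pi_n^{wh}(X,x_0)$ is the subgroup topology on $\pi_n(X,x_0)$ determined by $\Sigma^{wh}=\{\pi_n(i)(\pi_n(U,x_0))\mid U\text{ an open subset of }X\text{ containing }x_0\}$. *)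

(* Defs.v *)
From HB Require Import structures.
From mathcomp Require Import all_boot all_order all_algebra.
From mathcomp Require Import generic_quotient ring lra.
From mathcomp Require Import boolp classical_sets functions reals topology.
From mathcomp Require Import normedtype.

Set Implicit Arguments.
Unset Strict Implicit.
Unset Printing Implicit Defensive.

Import Order.TTheory GRing.Theory Num.Theory.
Import numFieldNormedType.Exports.

Local Open Scope classical_set_scope.
Local Open Scope ring_scope.
Local Open Scope quotient_scope.

Definition unit_interval (R : realType) : topologicalType :=
  set_type `[0, 1 : R]%classic.

Definition ival (R : realType) (s : unit_interval R) : R := val s.
Arguments ival : simpl never.

(* [0, 1]^n with the product topology *)
Definition cube (R : realType) (n : nat) : topologicalType :=
  {ptws 'I_n -> unit_interval R}.

Definition cube_boundary (R : realType) (n : nat) : set (cube R n) :=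
  [set t | exists i : 'I_n, ival (t i) = 0 \/ ival (t i) = 1].

Section interval_lemmas.
Context {R : realType}.
Implicit Types s : R.

Fact clamp_subproof s : Num.max 0 (Num.min 1 s) \in `[0, 1 : R]%classic.
Proof.
by rewrite inE/= in_itv/= le_max lexx/= ge_max ler01/= ge_min lexx.
Qed.

Definition clamp s : unit_interval R := SigSub (clamp_subproof s).
Arguments clamp : simpl never.

Lemma val_clamp s : ival (clamp s) = Num.max 0 (Num.min 1 s).
Proof. by []. Qed.

Lemma unit_itvP (s : unit_interval R) : 0 <= ival s <= 1.
Proof. by have := valP s; rewrite inE/= in_itv. Qed.

Lemma clampE s : 0 <= s <= 1 -> ival (clamp s) = s.
Proof. by case/andP=> s0 s1; rewrite val_clamp (min_idPr s1) (max_idPr s0). Qed.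

Lemma clamp_le0 s : s <= 0 -> ival (clamp s) = 0.
Proof.
move=> s0; rewrite val_clamp (min_idPr _) ?(le_trans s0)//.
exact/max_idPl.
Qed.

Lemma clamp_ge1 s : 1 <= s -> ival (clamp s) = 1.
Proof. by move=> s1; rewrite val_clamp (min_idPl s1) (max_idPr ler01). Qed.

Lemma clamp_val (s : unit_interval R) : clamp (ival s) = s.
Proof. by exact: val_inj (clampE (unit_itvP s)). Qed.

Lemma val_unit_continuous : continuous (fun s : unit_interval R => ival s).
Proof. by rewrite /ival; exact: initial_continuous. Qed.

Lemma clamp_continuous : continuous clamp.
Proof.
apply: continuous_comp_initial => s.
rewrite (_ : _ \o _ = fun s => Num.max 0 (Num.min 1 s)); last exact/funext.
apply: continuous_max; first exact: cst_continuous.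
by apply: continuous_min; [exact: cst_continuous|exact: cvg_id].
Qed.

End interval_lemmas.

Section continuity_lemmas.
Context {R : realType}.

Lemma continuous_pair {X Y Z : topologicalType} (f : Z -> X) (g : Z -> Y) :
  continuous f -> continuous g -> continuous (fun z => (f z, g z)).
Proof. by move=> cf cg z; apply: cvg_pair; [exact: cf|exact: cg]. Qed.

Lemma continuous_compose {X Y Z : topologicalType} (f : X -> Y) (g : Y -> Z) :
  continuous f -> continuous g -> continuous (fun x => g (f x)).
Proof.
by move=> cf cg x; apply: (@continuous_comp _ _ _ f g); [exact: cf|exact: cg].
Qed.

Lemma continuous_fst {X Y : topologicalType} : continuous (@fst X Y).
Proof. by move=> x; exact: cvg_fst. Qed.

Lemma continuous_snd {X Y : topologicalType} : continuous (@snd X Y).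
Proof. by move=> x; exact: cvg_snd. Qed.

Lemma coord_continuous n (i : 'I_n) : continuous (fun t : cube R n => t i).
Proof. exact: (@proj_continuous _ (fun=> unit_interval R) i). Qed.

Lemma cube_continuous {Z : topologicalType} n (f : Z -> cube R n) :
  (forall i, continuous (fun z => f z i)) -> continuous f.
Proof.
move=> cf z; apply/cvg_sup => i.
exact: (@continuous_comp_initial _ _ _ (fun t : cube R n => t i) f (cf i)).
Qed.

(* pasting along the closed sets p <= 1/2 and 1/2 <= p *)
Lemma paste_continuous {Z X : topologicalType} (p : Z -> R) (a b : Z -> X) :
  continuous p -> continuous a -> continuous b ->
  (forall z, p z = 2^-1 -> a z = b z) ->
  continuous (fun z => if p z <= 2^-1 then a z else b z).
Proof.
move=> cp ca cb ab.
pose A := p @^-1` [set r | r <= 2^-1]; pose B := p @^-1` [set r | 2^-1 <= r].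
have clA : closed A by apply: closed_comp; [move=> *; exact: cp|exact: closed_le].
have clB : closed B by apply: closed_comp; [move=> *; exact: cp|exact: closed_ge].
have AB : A `|` B = setT.
  by apply/seteqP; split=> // z _; rewrite /A /B /=; case: (leP (p z)) => [|/ltW];
    [left|right].
apply/continuous_subspace_setT; rewrite -AB; apply: withinU_continuous => //.
- apply: (@subspace_eq_continuous _ A _ a); last exact: continuous_subspaceT.
  by move=> z; rewrite inE /A /from_subspace => /= ->.
- apply: (@subspace_eq_continuous _ B _ b); last exact: continuous_subspaceT.
  move=> z; rewrite inE /B /from_subspace => /= pz; have [pz'|//] := leP (p z) 2^-1.
  by apply/esym/ab/eqP; rewrite eq_le pz pz'.
Qed.

End continuity_lemmas.

(* t with its first coordinate replaced by s, clamped to [0, 1] *)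
Definition set_coord0 (R : realType) (n : nat) (t : cube R n.+1) (s : R) :
    cube R n.+1 :=
  fun i => if i == ord0 then clamp s else t i.

Section set_coord0_lemmas.
Context {R : realType} {n : nat}.
Implicit Types (t : cube R n.+1) (s : R).

Lemma set_coord00 t s : set_coord0 t s ord0 = clamp s.
Proof. by []. Qed.

Lemma set_coord0_set t s s' : set_coord0 (set_coord0 t s) s' = set_coord0 t s'.
Proof. by apply/funext => i; rewrite /set_coord0; case: (i == ord0). Qed.

Lemma set_coord0_id t : set_coord0 t (ival (t ord0)) = t.
Proof.
by apply/funext => i; rewrite /set_coord0; case: eqP => // ->; rewrite clamp_val.
Qed.

Lemma set_coord0_continuous {Z : topologicalType} (f : Z -> cube R n.+1)
    (s : Z -> R) :
  continuous f -> continuous s -> continuous (fun z => set_coord0 (f z) (s z)).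
Proof.
move=> cf cs; apply: cube_continuous => i; rewrite /set_coord0.
case: (i == ord0); first exact: (continuous_compose cs clamp_continuous).
exact: (continuous_compose cf (@coord_continuous _ _ _)).
Qed.

Lemma set_coord0_le0 t s : s <= 0 -> cube_boundary (set_coord0 t s).
Proof. by move=> s0; exists ord0; left; rewrite set_coord00 clamp_le0. Qed.

Lemma set_coord0_ge1 t s : 1 <= s -> cube_boundary (set_coord0 t s).
Proof. by move=> s1; exists ord0; right; rewrite set_coord00 clamp_ge1. Qed.

Lemma set_coord0_boundary t (phi : R -> R) :
  cube_boundary t -> phi 0 = 0 \/ phi 0 = 1 -> phi 1 = 0 \/ phi 1 = 1 ->
  cube_boundary (set_coord0 t (phi (ival (t ord0)))).
Proof.
move=> [i ti] phi0 phi1; have [i0|i0] := eqVneq i ord0; last first.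
  by exists i; rewrite /set_coord0 (negbTE i0).
have H (r : R) : r = 0 \/ r = 1 -> cube_boundary (set_coord0 t r).
  by move=> [->|->]; [exact: set_coord0_le0|exact: set_coord0_ge1].
by rewrite -i0; case: ti => ->; exact: H.
Qed.

Lemma coord0_continuous {Z : topologicalType} (f : Z -> cube R n.+1) :
  continuous f -> continuous (fun z => ival (f z ord0)).
Proof.
move=> cf; apply: continuous_compose val_unit_continuous.
exact: (continuous_compose cf (@coord_continuous _ _ _)).
Qed.

End set_coord0_lemmas.

(* maps of pairs ([0, 1]^n, boundary) -> (X, x0) *)
Record nloop (R : realType) (n : nat) (X : topologicalType) (x0 : X) := NLoop {
  nloop_fun :> cube R n -> X;
  nloop_continuous : continuous nloop_fun;
  nloop_boundary : forall t, cube_boundary t -> nloop_fun t = x0 }.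

Lemma nloop_ext (R : realType) n (X : topologicalType) (x0 : X)
  (f g : nloop R n x0) : f =1 g -> f = g.
Proof.
case: f => f cf f0; case: g => g cg g0 /= /funext fg.
by case: _ / fg in cg g0 *; rewrite (Prop_irrelevance cf cg)
  (Prop_irrelevance f0 g0).
Qed.

(* homotopy relative to the boundary, which is sent to x0 at all times *)
Definition nloop_homotopic (R : realType) (n : nat) (X : topologicalType)
    (x0 : X) (f g : cube R n -> X) : Prop :=
  exists h : unit_interval R * cube R n -> X,
    [/\ continuous h,
        forall t, h (clamp 0, t) = f t,
        forall t, h (clamp 1, t) = g t &
        forall s t, cube_boundary t -> h (s, t) = x0].

Section nloop_homotopic_lemmas.
Context {R : realType} {n : nat} {X : topologicalType} {x0 : X}.
Local Notation homotopic := (@nloop_homotopic R n X x0).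

Lemma nloop_homotopic_refl (f : nloop R n x0) : homotopic f f.
Proof.
exists (fun z => f z.2); split=> //.
- exact: (continuous_compose continuous_snd (@nloop_continuous _ _ _ _ f)).
- by move=> s t; exact: nloop_boundary.
Qed.

Lemma nloop_homotopic_sym f g : homotopic f g -> homotopic g f.
Proof.
move=> [h [ch h0 h1 hb]]; exists (fun z => h (clamp (1 - ival z.1), z.2)).
split.
- apply: continuous_compose ch; apply: continuous_pair; last first.
    exact: continuous_snd.
  apply: (continuous_compose _ clamp_continuous) => z.
  apply: cvgB; first exact: cvg_cst.
  exact: (continuous_compose continuous_fst val_unit_continuous).
- by move=> t /=; rewrite clamp_le0// subr0 h1.
- by move=> t /=; rewrite clamp_ge1// subrr h0.
- by move=> s t; exact: hb.
Qed.

Lemma nloop_homotopic_trans f g k :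
  homotopic f g -> homotopic g k -> homotopic f k.
Proof.
move=> [h [ch h0 h1 hb]] [l [cl l0 l1 lb]].
exists (fun z => if ival z.1 <= 2^-1 then h (clamp (2 * ival z.1), z.2)
  else l (clamp (2 * ival z.1 - 1), z.2)).
have cp : continuous (fun z : unit_interval R * cube R n => ival z.1).
  exact: (continuous_compose continuous_fst val_unit_continuous).
have c2p : continuous (fun z : unit_interval R * cube R n => 2 * ival z.1).
  by move=> z; apply: cvgM; [exact: cvg_cst|exact: cp].
split.
- apply: paste_continuous => //.
  + apply: continuous_compose ch; apply: continuous_pair; last first.
      exact: continuous_snd.
    exact: (continuous_compose c2p clamp_continuous).
  + apply: continuous_compose cl; apply: continuous_pair; last first.
      exact: continuous_snd.
    apply: (continuous_compose _ clamp_continuous) => z.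
    by apply: cvgB; [exact: c2p|exact: cvg_cst].
  + by move=> z /= ->; rewrite mulfV ?pnatr_eq0// subrr h1 l0.
- by move=> t /=; rewrite clamp_le0// invr_ge0 ler0n mulr0 h0.
- move=> t /=; rewrite clamp_ge1// ifF; last lra.
  by rewrite mulr1 (_ : 2 - 1 = 1) ?l1//; lra.
- by move=> s t tb; case: ifP => _; [exact: hb|exact: lb].
Qed.

End nloop_homotopic_lemmas.

HB.instance Definition _ (R : realType) n (X : topologicalType) (x0 : X) :=
  gen_eqMixin (nloop R n x0).
HB.instance Definition _ (R : realType) n (X : topologicalType) (x0 : X) :=
  gen_choiceMixin (nloop R n x0).

Section homotopy_group_def.
Context (R : realType) (n : nat) (X : topologicalType) (x0 : X).

Definition nloop_homotopicb : rel (nloop R n x0) :=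
  fun f g => `[< nloop_homotopic x0 f g >].

Lemma nloop_homotopicb_refl : reflexive nloop_homotopicb.
Proof. by move=> f; apply/asboolP; exact: nloop_homotopic_refl. Qed.

Lemma nloop_homotopicb_sym : symmetric nloop_homotopicb.
Proof.
by move=> f g; apply/asboolP/asboolP; exact: nloop_homotopic_sym.
Qed.

Lemma nloop_homotopicb_trans : transitive nloop_homotopicb.
Proof.
by move=> g f h /asboolP fg /asboolP gh; apply/asboolP/(nloop_homotopic_trans fg).
Qed.

Canonical nloop_homotopicb_equiv := EquivRel nloop_homotopicb
  nloop_homotopicb_refl nloop_homotopicb_sym nloop_homotopicb_trans.

Definition homotopy_group : Type := {eq_quot nloop_homotopicb}.

HB.instance Definition _ := Choice.on homotopy_group.
HB.instance Definition _ := EqQuotient.on homotopy_group.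

Definition hclass (f : nloop R n x0) : homotopy_group := \pi f.

Lemma hclassP (f g : nloop R n x0) :
  hclass f = hclass g <-> nloop_homotopic x0 f g.
Proof.
split; first by move=> /eqquotP/asboolP.
by move=> fg; apply/eqquotP/asboolP.
Qed.

Lemma hclass_repr (a : homotopy_group) : hclass (repr a) = a.
Proof. exact: reprK. Qed.

Lemma hclass_surj (a : homotopy_group) : exists f, a = hclass f.
Proof. by exists (repr a); rewrite hclass_repr. Qed.

End homotopy_group_def.

Section nloop_operations.
Context {R : realType} {n : nat} {X : topologicalType} {x0 : X}.
Local Notation homotopic := (@nloop_homotopic R n.+1 X x0).
Implicit Types f g h : nloop R n.+1 x0.

Definition concat_fun (f g : cube R n.+1 -> X) (t : cube R n.+1) : X :=
  if ival (t ord0) <= 2^-1 then f (set_coord0 t (2 * ival (t ord0)))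
  else g (set_coord0 t (2 * ival (t ord0) - 1)).

Definition inv_fun (f : cube R n.+1 -> X) (t : cube R n.+1) : X :=
  f (set_coord0 t (1 - ival (t ord0))).

(* F and G are families of functions on the cube indexed by Z *)
Lemma concat_fun_continuous {Z : topologicalType} (F G : Z * cube R n.+1 -> X) :
  continuous F -> continuous G ->
  (forall z t, cube_boundary t -> F (z, t) = x0) ->
  (forall z t, cube_boundary t -> G (z, t) = x0) ->
  continuous (fun zt : Z * cube R n.+1 =>
    concat_fun (fun t => F (zt.1, t)) (fun t => G (zt.1, t)) zt.2).
Proof.
move=> cF cG F0 G0; rewrite /concat_fun.
have cp : continuous (fun zt : Z * cube R n.+1 => ival (zt.2 ord0)).
  exact: coord0_continuous continuous_snd.
have c2p : continuous (fun zt : Z * cube R n.+1 => 2 * ival (zt.2 ord0)).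
  by move=> z; apply: cvgM; [exact: cvg_cst|exact: cp].
apply: paste_continuous => //.
- apply: continuous_compose cF; apply: continuous_pair continuous_fst _.
  exact: set_coord0_continuous continuous_snd _.
- apply: continuous_compose cG; apply: continuous_pair continuous_fst _.
  apply: set_coord0_continuous continuous_snd _ => z.
  by apply: cvgB; [exact: c2p|exact: cvg_cst].
- move=> z ->; rewrite mulfV ?pnatr_eq0// subrr F0 ?G0//.
  + exact: set_coord0_le0.
  + exact: set_coord0_ge1.
Qed.

Lemma concat_fun_boundary (f g : cube R n.+1 -> X) :
  (forall t, cube_boundary t -> f t = x0) ->
  (forall t, cube_boundary t -> g t = x0) ->
  forall t, cube_boundary t -> concat_fun f g t = x0.
Proof.
move=> f0 g0 t [i]; have [->|i0] := eqVneq i ord0.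
  rewrite /concat_fun => -[|] ->.
    by rewrite invr_ge0 ler0n f0// mulr0; exact: set_coord0_le0.
  by rewrite ifF ?g0//; [apply: set_coord0_ge1; lra|lra].
move=> ti; rewrite /concat_fun; case: ifP => _; [apply: f0|apply: g0];
  by exists i; rewrite /set_coord0 (negbTE i0).
Qed.

Fact concat_subproof f g : continuous (concat_fun f g).
Proof.
have := @concat_fun_continuous (cube R n.+1) (fun z => f z.2) (fun z => g z.2)
  (continuous_compose continuous_snd (@nloop_continuous _ _ _ _ f))
  (continuous_compose continuous_snd (@nloop_continuous _ _ _ _ g))
  (fun=> @nloop_boundary _ _ _ _ f) (fun=> @nloop_boundary _ _ _ _ g).
apply: (@continuous_compose _ _ _ (fun t : cube R n.+1 => (t, t))).
by apply: continuous_pair => t; exact: cvg_id.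
Qed.

Definition nloop_concat f g : nloop R n.+1 x0 :=
  NLoop (@concat_subproof f g)
    (concat_fun_boundary (@nloop_boundary _ _ _ _ f) (@nloop_boundary _ _ _ _ g)).

Fact reparam_continuous (phi : R -> R) f : continuous phi ->
  continuous (fun t => f (set_coord0 t (phi (ival (t ord0))))).
Proof.
move=> cphi; apply: continuous_compose (@nloop_continuous _ _ _ _ f).
apply: set_coord0_continuous => [t|]; first exact: cvg_id.
apply: (continuous_compose (f := fun t : cube R n.+1 => ival (t ord0)) _ cphi).
by apply: (@coord0_continuous _ _ _ (fun t : cube R n.+1 => t)) => t; exact: cvg_id.
Qed.

Fact inv_continuous f : continuous (inv_fun f).
Proof.
apply: (@reparam_continuous (fun s => 1 - s)) => s.
by apply: cvgB; [exact: cvg_cst|exact: cvg_id].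
Qed.

Fact inv_boundary f t : cube_boundary t -> inv_fun f t = x0.
Proof.
move=> tb; apply: nloop_boundary.
apply: (@set_coord0_boundary _ _ _ (fun s => 1 - s)) => //.
  by right; rewrite subr0.
by left; rewrite subrr.
Qed.

Definition nloop_inv f : nloop R n.+1 x0 :=
  NLoop (@inv_continuous f) (@inv_boundary f).

Definition nloop_cst : nloop R n.+1 x0 :=
  NLoop (fun t => @cst_continuous _ _ x0 t) (fun _ _ => erefl).

Lemma concat_homotopic f f' g g' : homotopic f f' -> homotopic g g' ->
  homotopic (nloop_concat f g) (nloop_concat f' g').
Proof.
move=> [h [ch h0 h1 hb]] [l [cl l0 l1 lb]].
exists (fun zt => concat_fun (fun t => h (zt.1, t)) (fun t => l (zt.1, t)) zt.2).
split; first exact: concat_fun_continuous.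
- by move=> t /=; rewrite /concat_fun /= h0 l0.
- by move=> t /=; rewrite /concat_fun /= h1 l1.
- by move=> s t tb; apply: concat_fun_boundary tb => t' ?; [exact: hb|exact: lb].
Qed.

Lemma inv_homotopic f f' : homotopic f f' ->
  homotopic (nloop_inv f) (nloop_inv f').
Proof.
move=> [h [ch h0 h1 hb]].
exists (fun zt => inv_fun (fun t => h (zt.1, t)) zt.2); split.
- apply: continuous_compose ch; apply: continuous_pair continuous_fst _.
  apply: set_coord0_continuous continuous_snd _ => z.
  apply: cvgB; first exact: cvg_cst.
  exact: (coord0_continuous continuous_snd).
- by move=> t /=; rewrite /inv_fun h0.
- by move=> t /=; rewrite /inv_fun h1.
- move=> s t tb; apply: hb.
  apply: (@set_coord0_boundary _ _ _ (fun s => 1 - s)) => //.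
    by right; rewrite subr0.
  by left; rewrite subrr.
Qed.

(* straight-line homotopy between two reparametrisations of f *)
Lemma reparam_homotopic f (phi psi : R -> R) (g h : nloop R n.+1 x0) :
  continuous phi -> continuous psi ->
  phi 0 = psi 0 -> phi 1 = psi 1 ->
  phi 0 = 0 \/ phi 0 = 1 -> phi 1 = 0 \/ phi 1 = 1 ->
  (forall t, g t = f (set_coord0 t (phi (ival (t ord0))))) ->
  (forall t, h t = f (set_coord0 t (psi (ival (t ord0))))) ->
  homotopic g h.
Proof.
move=> cphi cpsi e0 e1 p0 p1 gE hE.
pose chi (u s : R) := (1 - u) * phi s + u * psi s.
exists (fun zt => f (set_coord0 zt.2 (chi (ival zt.1) (ival (zt.2 ord0))))).
have cu : continuous (fun zt : unit_interval R * cube R n.+1 => ival zt.1).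
  exact: (continuous_compose continuous_fst val_unit_continuous).
have ct : continuous (fun zt : unit_interval R * cube R n.+1 => ival (zt.2 ord0)).
  exact: (coord0_continuous continuous_snd).
split.
- apply: continuous_compose (@nloop_continuous _ _ _ _ f).
  apply: set_coord0_continuous continuous_snd _ => z.
  apply: cvgD; apply: cvgM.
  + by apply: cvgB; [exact: cvg_cst|exact: cu].
  + exact: (continuous_compose ct cphi).
  + exact: cu.
  + exact: (continuous_compose ct cpsi).
- by move=> t /=; rewrite clamp_le0// /chi subr0 mul1r mul0r addr0 gE.
- by move=> t /=; rewrite clamp_ge1// /chi subrr mul1r mul0r add0r hE.
- move=> s t tb; apply: nloop_boundary.
  by apply: (@set_coord0_boundary _ _ _ (chi (ival s))) => //=;
    rewrite /chi -?e0 -?e1 -mulrDl subrK mul1r.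
Qed.

End nloop_operations.

Section homotopy_group_structure.
Context (R : realType) (n : nat) (X : topologicalType) (x0 : X).
Local Notation G := (homotopy_group R n.+1 x0).
Local Notation homotopic := (@nloop_homotopic R n.+1 X x0).
Implicit Types f g h : nloop R n.+1 x0.

Definition hmul (a b : G) : G := hclass (nloop_concat (repr a) (repr b)).
Definition hinv (a : G) : G := hclass (nloop_inv (repr a)).
Definition hone : G := hclass (nloop_cst (x0 := x0)).

Lemma hmulE f g : hmul (hclass f) (hclass g) = hclass (nloop_concat f g).
Proof.
by apply/hclassP/concat_homotopic; apply/hclassP; rewrite hclass_repr.
Qed.

Lemma hinvE f : hinv (hclass f) = hclass (nloop_inv f).
Proof. by apply/hclassP/inv_homotopic; apply/hclassP; rewrite hclass_repr. Qed.

Let affine_continuous (a b : R) : continuous (fun s : R => a * s + b).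
Proof.
move=> s; apply: cvgD; last exact: cvg_cst.
by apply: cvgM; [exact: cvg_cst|exact: cvg_id].
Qed.

Let minf_continuous (u v : R -> R) : continuous u -> continuous v ->
  continuous (fun s => Num.min (u s) (v s)).
Proof. by move=> cu cv s; apply: continuous_min; [exact: cu|exact: cv]. Qed.

Let maxf_continuous (u v : R -> R) : continuous u -> continuous v ->
  continuous (fun s => Num.max (u s) (v s)).
Proof. by move=> cu cv s; apply: continuous_max; [exact: cu|exact: cv]. Qed.

Lemma hmulA : associative hmul.
Proof.
move=> a b c; have [f ->] := hclass_surj a; have [g ->] := hclass_surj b.
have [h ->] := hclass_surj c; rewrite !hmulE; apply/hclassP.
pose phi (s : R) := Num.min (2 * s + 0) (Num.min (1 * s + 4^-1) (2^-1 * s + 2^-1)).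
apply: (@reparam_homotopic _ _ _ _ (nloop_concat f (nloop_concat g h)) id phi).
- by move=> s; exact: cvg_id.
- apply: minf_continuous; first exact: affine_continuous.
  by apply: minf_continuous; exact: affine_continuous.
- by rewrite /phi /Num.min; do ?case: ifP; lra.
- by rewrite /phi /Num.min; do ?case: ifP; lra.
- by left.
- by right.
- by move=> t; rewrite set_coord0_id.
move=> t; have /andP[t0 t1] := unit_itvP (t ord0).
rewrite /= /concat_fun /= set_coord00 !set_coord0_set.
set s := ival (t ord0) in t0 t1 *.
have phi01 : 0 <= phi s <= 1 by rewrite /phi /Num.min; do ?case: ifP; lra.
rewrite (clampE phi01).
have [s2|s2] := leP s 2^-1; last first.
  have -> : phi s = 2^-1 * s + 2^-1 by rewrite /phi /Num.min; do ?case: ifP; lra.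
  rewrite ifF; last lra.
  rewrite set_coord00 clampE; last lra.
  rewrite ifF; last lra.
  by congr (h (set_coord0 _ _)); lra.
rewrite (@clampE _ (2 * s)); last lra.
have [s4|s4] := leP (2 * s) 2^-1.
  have -> : phi s = 2 * s by rewrite /phi /Num.min; do ?case: ifP; lra.
  by rewrite s4.
have -> : phi s = s + 4^-1 by rewrite /phi /Num.min; do ?case: ifP; lra.
rewrite ifF; last lra.
rewrite set_coord00 clampE; last lra.
by rewrite ifT; [congr (g (set_coord0 _ _)); lra|lra].
Qed.

Lemma hmul1 : right_id hone hmul.
Proof.
move=> a; have [f ->] := hclass_surj a; rewrite hmulE; apply/hclassP.
apply: (@reparam_homotopic _ _ _ _ f (fun s => Num.min 1 (2 * s + 0)) id).
- apply: minf_continuous; first by move=> s; exact: cvg_cst.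
  exact: affine_continuous.
- by move=> s; exact: cvg_id.
- by rewrite /Num.min; do ?case: ifP; lra.
- by rewrite /Num.min; do ?case: ifP; lra.
- by left; rewrite /Num.min; do ?case: ifP; lra.
- by right; rewrite /Num.min; do ?case: ifP; lra.
- move=> t; rewrite /= /concat_fun addr0; case: leP => t2.
    by rewrite (min_idPr _)//; lra.
  rewrite (min_idPl _); last lra.
  by rewrite nloop_boundary//; exact: set_coord0_ge1.
- by move=> t; rewrite set_coord0_id.
Qed.

Lemma hmul1l : left_id hone hmul.
Proof.
move=> a; have [f ->] := hclass_surj a; rewrite hmulE; apply/hclassP.
apply: (@reparam_homotopic _ _ _ _ f (fun s => Num.max 0 (2 * s - 1)) id).
- apply: maxf_continuous; first by move=> s; exact: cvg_cst.
  exact: affine_continuous.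
- by move=> s; exact: cvg_id.
- by rewrite /Num.max; do ?case: ifP; lra.
- by rewrite /Num.max; do ?case: ifP; lra.
- by left; rewrite /Num.max; do ?case: ifP; lra.
- by right; rewrite /Num.max; do ?case: ifP; lra.
- move=> t; rewrite /= /concat_fun; case: leP => t2.
    rewrite (max_idPl _); last lra.
    by rewrite nloop_boundary//; exact: set_coord0_le0.
  by rewrite (max_idPr _)//; lra.
- by move=> t; rewrite set_coord0_id.
Qed.

Lemma hmulV : right_inverse hone hinv hmul.
Proof.
move=> a; have [f ->] := hclass_surj a; rewrite hinvE hmulE; apply/hclassP.
apply: (@reparam_homotopic _ _ _ _ f
  (fun s => Num.min (2 * s + 0) (- 2 * s + 2)) (fun=> 0)).
- by apply: minf_continuous; exact: affine_continuous.
- by move=> s; exact: cvg_cst.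
- by rewrite /Num.min; do ?case: ifP; lra.
- by rewrite /Num.min; do ?case: ifP; lra.
- by left; rewrite /Num.min; do ?case: ifP; lra.
- by left; rewrite /Num.min; do ?case: ifP; lra.
- move=> t; have /andP[t0 t1] := unit_itvP (t ord0).
  rewrite /= /concat_fun; case: leP => t2.
    by rewrite (min_idPl _) ?addr0//; lra.
  rewrite (min_idPr _); last lra.
  rewrite /= /inv_fun set_coord0_set set_coord00 clampE; last lra.
  by congr (f (set_coord0 _ _)); lra.
- by move=> t; apply/esym/nloop_boundary; exact: set_coord0_le0.
Qed.

Lemma hmulVl : left_inverse hone hinv hmul.
Proof.
move=> a; have [f ->] := hclass_surj a; rewrite hinvE hmulE; apply/hclassP.
apply: (@reparam_homotopic _ _ _ _ f
  (fun s => Num.max (- 2 * s + 1) (2 * s - 1)) (fun=> 1)).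
- by apply: maxf_continuous; exact: affine_continuous.
- by move=> s; exact: cvg_cst.
- by rewrite /Num.max; do ?case: ifP; lra.
- by rewrite /Num.max; do ?case: ifP; lra.
- by right; rewrite /Num.max; do ?case: ifP; lra.
- by right; rewrite /Num.max; do ?case: ifP; lra.
- move=> t; have /andP[t0 t1] := unit_itvP (t ord0).
  rewrite /= /concat_fun; case: leP => t2.
    rewrite (max_idPl _); last lra.
    rewrite /= /inv_fun set_coord0_set set_coord00 clampE; last lra.
    by congr (f (set_coord0 _ _)); lra.
  by rewrite (max_idPr _)//; lra.
- by move=> t; apply/esym/nloop_boundary; exact: set_coord0_ge1.
Qed.

HB.instance Definition _ := isGroup.Build G hmulA hmul1l hmul1 hmulVl hmulV.

End homotopy_group_structure.

Section induced_map.
Context (R : realType) (n : nat) (X Y : topologicalType) (x0 : X) (y0 : Y).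
Context (f : Y -> X) (cf : continuous f) (fy0 : f y0 = x0).

Fact nloop_comp_boundary (l : nloop R n y0) t : cube_boundary t -> f (l t) = x0.
Proof. by move=> tb; rewrite nloop_boundary. Qed.

Definition nloop_comp (l : nloop R n y0) : nloop R n x0 :=
  NLoop (continuous_compose (@nloop_continuous _ _ _ _ l) cf)
    (@nloop_comp_boundary l).

Definition induced_map (a : homotopy_group R n y0) : homotopy_group R n x0 :=
  hclass (nloop_comp (repr a)).

Lemma induced_mapE (l : nloop R n y0) :
  induced_map (hclass l) = hclass (nloop_comp l).
Proof.
apply/hclassP.
have /hclassP[h [ch h0 h1 hb]] : hclass (repr (hclass l)) = hclass l.
  by rewrite hclass_repr.
exists (f \o h); split.
- exact: (continuous_compose ch cf).
- by move=> t /=; rewrite h0.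
- by move=> t /=; rewrite h1.
- by move=> s t tb /=; rewrite hb.
Qed.

End induced_map.

Lemma induced_mapM (R : realType) (n : nat) (X Y : topologicalType) (x0 : X)
    (y0 : Y) (f : Y -> X) (cf : continuous f) (fy0 : f y0 = x0)
    (a b : homotopy_group R n.+1 y0) :
  induced_map cf fy0 (a * b)%g =
  (induced_map cf fy0 a * induced_map cf fy0 b)%g.
Proof.
have [k ->] := hclass_surj a; have [l ->] := hclass_surj b.
rewrite [(hclass k * _)%g]hmulE !induced_mapE [RHS]hmulE; congr hclass.
by apply: nloop_ext => t; rewrite /= /concat_fun/=; case: ifP.
Qed.

Definition subgroup (G : groupType) (H : set G) : Prop := group_closed [in H].

Lemma subgroupP (G : groupType) (H : set G) :
  subgroup H <-> H 1%g /\ forall a b, H a -> H b -> H (a / b)%g.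
Proof.
split=> [[/set_mem H1 Hdiv]|[H1 Hdiv]].
  by split=> // a b /mem_set Ha /mem_set Hb; exact/set_mem/Hdiv.
by split; [exact/mem_set|move=> a b /set_mem Ha /set_mem Hb; exact/mem_set/Hdiv].
Qed.

Definition left_coset (G : groupType) (g : G) (H : set G) : set G :=
  [set (g * h)%g | h in H].

Definition left_cosets (G : groupType) (Sigma : set (set G)) : set (set G) :=
  [set C | exists g H, Sigma H /\ C = left_coset g H].

Record nbhd_family (G : groupType) := NbhdFamily {
  nbhd_family_set :> set (set G);
  nbhd_family_neq0 : nbhd_family_set !=set0;
  nbhd_family_subgroup : forall H, nbhd_family_set H -> subgroup H;
  nbhd_family_directed : forall H K, nbhd_family_set H -> nbhd_family_set K ->
    exists2 S, nbhd_family_set S & S `<=` H `&` K }.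

(* G with the topology having the left cosets of the members of Sigma as a base *)
Definition subgroup_topology (G : groupType) (Sigma : nbhd_family G) : Type := G.

Section subgroup_topology_instances.
Context (G : groupType) (Sigma : nbhd_family G).
Local Notation T := (subgroup_topology Sigma).

HB.instance Definition _ := Group.on T.

Fact left_cosets_cover : \bigcup_(C in left_cosets Sigma) C = [set: T].
Proof.
apply/seteqP; split=> // g _; have [H SH] := nbhd_family_neq0 Sigma.
exists (left_coset g H); first by exists g, H.
by exists 1%g; [have /subgroupP[] := nbhd_family_subgroup SH|rewrite mulg1].
Qed.

Fact left_cosets_join (C D : set G) (g : G) :
  left_cosets Sigma C -> left_cosets Sigma D -> C g -> D g ->
  exists E, [/\ left_cosets Sigma E, E g & E `<=` C `&` D].
Proof.
move=> [a [H [SH ->]]] [b [K [SK ->]]] [h Hh <-{g}] [k Kk bk].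
have [L SL LHK] := nbhd_family_directed SH SK.
have sub (M : set G) : nbhd_family_set Sigma M -> forall x y, M x -> M y -> M (x * y)%g.
  move=> /nbhd_family_subgroup/group_closedM MM x y /mem_set Mx /mem_set My.
  exact/set_mem/MM.
exists (left_coset (a * h)%g L); split.
- by exists (a * h)%g, L.
- by exists 1%g; [have /subgroupP[] := nbhd_family_subgroup SL|rewrite mulg1].
- move=> _ [l Ll <-]; have [Hl Kl] := LHK _ Ll; split.
    by exists (h * l)%g; [exact: sub|rewrite mulgA].
  by exists (k * l)%g; [exact: sub|rewrite mulgA bk].
Qed.

HB.instance Definition _ := @isBaseTopological.Build T
  (set G) (left_cosets Sigma) id left_cosets_cover left_cosets_join.

Lemma subgroup_topology_openP (A : set G) :
  open (A : set T) <->
  exists2 D, D `<=` left_cosets Sigma & \bigcup_(C in D) C = A.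
Proof. by []. Qed.

End subgroup_topology_instances.

Section neighbourhood_image.
Context (R : realType) (n : nat) (X : topologicalType) (x0 : X).

(* the image of pi_n(U, x0) in pi_n(X, x0), where U has the subspace topology *)
Definition nbhd_image (U : set X) (Ux0 : U x0) : set (homotopy_group R n x0) :=
  range (@induced_map R n X (set_type U) x0 (SigSub (mem_set Ux0)) set_val
    (@initial_continuous _ _ _) erefl).

Lemma nbhd_imageP (U : set X) (Ux0 : U x0) (a : homotopy_group R n x0) :
  nbhd_image Ux0 a <->
  exists f : nloop R n x0, (forall t, U (f t)) /\ a = hclass f.
Proof.
split.
  move=> [b _ <-]; have [k ->] := hclass_surj b; rewrite induced_mapE.
  by eexists; split=> // t; exact: set_valP.
move=> [f [fU ->]]; pose g t : set_type U := SigSub (mem_set (fU t)).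
have cg : continuous g.
  by apply: continuous_comp_initial; exact: nloop_continuous.
have gb t : cube_boundary t -> g t = SigSub (mem_set Ux0).
  by move=> tb; apply: val_inj; exact: (nloop_boundary f tb).
exists (hclass (NLoop cg gb)) => //; rewrite induced_mapE.
by congr hclass; exact: nloop_ext.
Qed.

End neighbourhood_image.

Lemma nbhd_image_subgroup (R : realType) (n : nat) (X : topologicalType)
    (x0 : X) (U : set X) (Ux0 : U x0) : subgroup (@nbhd_image R n.+1 X x0 U Ux0).
Proof.
apply/subgroupP; rewrite /nbhd_image; set phi := induced_map _ _.
have phiM a b : phi (a * b)%g = (phi a * phi b)%g by exact: induced_mapM.
split.
  by exists 1%g => //; apply: (@mulgI _ (phi 1%g)); rewrite -phiM !mulg1.
move=> _ _ [a _ <-] [b _ <-]; exists (a / b)%g => //.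
by apply: (@mulIg _ (phi b)); rewrite -phiM !mulgVK.
Qed.

Section whisker_topology.
Context (R : realType) (n : nat) (X : topologicalType) (x0 : X).

Definition whisker_family_set : set (set (homotopy_group R n.+1 x0)) :=
  [set K | exists (U : set X) (Ux0 : U x0), open U /\ K = nbhd_image Ux0].

Fact whisker_family_neq0 : whisker_family_set !=set0.
Proof. by eexists; exists setT, I; split; [exact: openT|reflexivity]. Qed.

Fact whisker_family_subgroup K : whisker_family_set K -> subgroup K.
Proof. by move=> [U [Ux0 [_ ->]]]; exact: nbhd_image_subgroup. Qed.

Fact whisker_family_directed H K :
  whisker_family_set H -> whisker_family_set K ->
  exists2 S, whisker_family_set S & S `<=` H `&` K.
Proof.
move=> [U [Ux0 [oU ->]]] [V [Vx0 [oV ->]]].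
exists (nbhd_image (conj Ux0 Vx0 : (U `&` V) x0)).
  by exists (U `&` V), (conj Ux0 Vx0); split=> //; exact: openI.
by move=> a /nbhd_imageP[f [fUV ->]]; split; apply/nbhd_imageP; exists f;
  split=> // t; case: (fUV t).
Qed.

Definition whisker_family : nbhd_family (homotopy_group R n.+1 x0) :=
  NbhdFamily whisker_family_neq0 whisker_family_subgroup whisker_family_directed.

(* dimension n.+1: the underlying group is homotopy_group R n.+1 x0 *)
Definition whisker_homotopy_group : Type := subgroup_topology whisker_family.

HB.instance Definition _ := Group.on whisker_homotopy_group.
HB.instance Definition _ := Topological.on whisker_homotopy_group.

End whisker_topology.

Definition semilocally_connected_wrt (R : realType) (n : nat)
    (X : topologicalType) (x0 : X) (H : set (homotopy_group R n x0)) : Prop :=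
  exists (U : set X) (Ux0 : U x0), open U /\ nbhd_image Ux0 `<=` H.

(* Main.v *)
Require Import Defs.
From mathcomp Require Import all_boot all_order all_algebra.
From mathcomp Require Import boolp classical_sets functions reals topology.

Local Open Scope classical_set_scope.

(** The statement is pure group theory: in any subgroup topology, a subgroup is open exactly when it
    contains a member of the family ([open_subgroupP]). An open subgroup contains a basic coset
    through 1, and a coset of [S] through 1 is [S] itself; conversely, a subgroup containing [S] is
    a union of cosets of [S]. For the whisker family, whose members are the images of open
    neighbourhoods of [x0], containing a member is semilocal connectedness. *)

Lemma subgroupM (G : groupType) (H : set G) (a b : G) :
  subgroup H -> H a -> H b -> H (a * b)%g.
Proof.
move=> /group_closedM HM /mem_set Ha /mem_set Hb.
exact/set_mem/HM.
Qed.

Lemma open_subgroupP (G : groupType) (Sigma : nbhd_family G) (H : set G) :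
  subgroup H ->
  open (H : set (subgroup_topology Sigma)) <->
  exists2 S, nbhd_family_set Sigma S & S `<=` H.
Proof.
move=> sgH; have [H1 _] := (subgroupP _).1 sgH.
rewrite subgroup_topology_openP; split.
- move=> [D Dcos DH]; move: H1; rewrite -DH => -[C DC].
  have [g [S [SS CE]]] := Dcos _ DC; rewrite CE => -[s Ss gs1].
  (* Since [g * s = 1], each [k] in [S] equals [g * (s * k)], so it lies in the coset [C]. *)
  exists S => // k Sk; exists C => //; rewrite CE; exists (s * k)%g.
    by apply: subgroupM => //; exact: nbhd_family_subgroup SS.
  by rewrite mulgA gs1 mul1g.
- move=> [S SS SH].
  (* [H] is the union of the cosets of [S] by its own elements. *)
  exists [set C | exists2 h, H h & C = left_coset h S].
    by move=> _ [h _ ->]; exists h, S.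
  apply/seteqP; split=> [_ [_ [h Hh ->] [s Ss <-]]|h Hh].
    by apply: subgroupM => //; exact: SH.
  exists (left_coset h S); first by exists h.
  have [S1 _] := (subgroupP _).1 (nbhd_family_subgroup SS).
  by exists 1%g; rewrite ?mulg1.
Qed.

Theorem theorem4p5 (R : realType) (n : nat) (hn : (2 <= n.+1)%N)
    (X : topologicalType) (x0 : X)
    (H : set (homotopy_group R n.+1 x0)) (hH : subgroup H) :
  semilocally_connected_wrt H <->
  open (H : set (whisker_homotopy_group R n x0)).
Proof.
apply: iff_trans (iff_sym (open_subgroupP _ (whisker_family R n x0) _ hH)).
split.
- move=> [U [Ux0 [oU UH]]]; exists (nbhd_image Ux0) => //.
  by exists U, Ux0.
- by move=> [_ [U [Ux0 [oU ->]]] UH]; exists U, Ux0.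
Qed.
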